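(* The set $\mathcal{D}_{\mathrm{adm}}$ consists of the quadruples $(z,z',w,w')\in\mathcal{D}$ satisfying the following two conditions: First, both $(z,z')$ and $(w,w')$ belong to $\mathcal{Z}$. Second, in the particular case when both $(z,z')$ and $(w,w')$ are in $\mathcal{Z}_{\mathrm{degen}}$, an extra condition is added: let $k,l\in\mathbb{Z}$ be such that $(z,z')\in\mathcal{Z}_{\mathrm{degen},k}$ and $(w,w')\in\mathcal{Z}_{\mathrm{degen},l}$; then it is required that $k+l\ge1$.
   Context: $\mathcal{D}=\{(z,z',w,w')\in\mathbb{C}^4\mid\Re(z+z'+w+w')>-1\}$. $\mathbb{GT}_N$ is the set of integer $N$-tuples $\lambda=(\lambda_1\ge\dots\ge\lambda_N)$, $\mathrm{Dim}_N(\lambda)=\prod_{1\le i<j\le N}\frac{\lambda_i-\lambda_j+j-i}{j-i}$, and $$P'_N(\lambda\mid z,z',w,w')=\mathrm{Dim}_N^2(\lambda)\prod_{i=1}^N\frac1{\Gamma(z-\lambda_i+i)\Gamma(z'-\lambda_i+i)\Gamma(w+N+1+\lambda_i-i)\Gamma(w'+N+1+\lambda_i-i)}$$ (with $1/\Gamma$ entire). $\mathcal{D}_{\mathrm{adm}}$ is the set of $(z,z',w,w')\in\mathcal{D}$ such that $P'_N(\lambda\mid z,z',w,w')\ge0$ for all $N\ge1$, $\lambda\in\mathbb{GT}_N$, and for every $N\ge1$ the inequality is strict for at least two different $\lambda\in\mathbb{GT}_N$. The subset $\mathcal{Z}\subset\mathbb{C}^2$ is the disjoint union $\mathcal{Z}=\mathcal{Z}_{\mathrm{princ}}\sqcup\mathcal{Z}_{\mathrm{compl}}\sqcup\mathcal{Z}_{\mathrm{degen}}$,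 where $\mathcal{Z}_{\mathrm{princ}}=\{(z,z')\in\mathbb{C}^2\setminus\mathbb{R}^2\mid z'=\bar z\}$; $\mathcal{Z}_{\mathrm{compl}}=\{(z,z')\in\mathbb{R}^2\mid\exists m\in\mathbb{Z}:\ m<z,z'<m+1\}$ (both $z$ and $z'$ lie in the open interval $(m,m+1)$); $\mathcal{Z}_{\mathrm{degen}}=\bigsqcup_{m\in\mathbb{Z}}\mathcal{Z}_{\mathrm{degen},m}$ with $\mathcal{Z}_{\mathrm{degen},m}=\{(z,z')\in\mathbb{R}^2\mid z=m,\ z'>m-1,\ \text{or}\ z'=m,\ z>m-1\}$. *)

(* Defs.v *)
From HB Require Import structures.
From mathcomp Require Import all_boot all_order all_algebra.
From mathcomp Require Import complex.
From mathcomp Require Import all_classical all_reals all_analysis.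

Set Implicit Arguments.
Unset Strict Implicit.
Unset Printing Implicit Defensive.

Import Order.TTheory GRing.Theory Num.Theory.
Import numFieldNormedType.Exports.

Local Open Scope classical_set_scope.
Local Open Scope ring_scope.
Local Open Scope complex_scope.

(* In R[i], the order x <= y means that y - x is real and nonnegative, so
   [0 <= x] and [0 < x] include the assertion that x is real. *)

Definition cexp (R : realType) (z : R[i]) : R[i] :=
  (expR (complex.Re z))%:C * (cos (complex.Im z) +i* sin (complex.Im z)).

(* The entire function 1/Gamma, by Gauss's formula, valid for every complex s:
     1/Gamma(s) = lim_n s (s + 1) ... (s + n) / (n! n^s),  n^s = exp(s ln n).
   The ascription to numClosedFieldType provides the topology of the
   modulus on R[i]. *)
Definition rGamma_seq (R : realType) (s : R[i]) (n : nat) : R[i] :=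
  (\prod_(k < n.+1) (s + k%:R)) / (n`!%:R * cexp (s * (ln n%:R)%:C)).

Definition rGamma (R : realType) (s : R[i]) : R[i] :=
  limn (rGamma_seq s : nat -> (R[i] : numClosedFieldType)).

(* Signatures are indexed from 0: [lam i] is lambda_(i+1). *)
Definition GT (N : nat) : set {ffun 'I_N -> int} :=
  [set lam | forall i j : 'I_N, (i <= j)%N -> lam j <= lam i].

Definition Dim (R : realType) (N : nat) (lam : {ffun 'I_N -> int}) : R[i] :=
  \prod_(i < N) \prod_(j < N | (i < j)%N)
    ((lam i - lam j + j%:Z - i%:Z)%:~R / (j%:Z - i%:Z)%:~R).

Definition Pprime (R : realType) (N : nat) (lam : {ffun 'I_N -> int})
    (z z' w w' : R[i]) : R[i] :=
  Dim R lam ^+ 2 *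
  \prod_(i < N)
    (rGamma (z - (lam i)%:~R + i.+1%:R) *
     rGamma (z' - (lam i)%:~R + i.+1%:R) *
     rGamma (w + N%:R + 1 + (lam i)%:~R - i.+1%:R) *
     rGamma (w' + N%:R + 1 + (lam i)%:~R - i.+1%:R)).

Definition calD (R : realType) : set (R[i] * R[i] * R[i] * R[i]) :=
  [set q | let: (z, z', w, w') := q in
    -1 < complex.Re (z + z' + w + w')].

Definition Dadm (R : realType) : set (R[i] * R[i] * R[i] * R[i]) :=
  [set q | let: (z, z', w, w') := q in
    [/\ calD (z, z', w, w'),
        forall (N : nat) (lam : {ffun 'I_N -> int}), (1 <= N)%N -> GT lam ->
          0 <= Pprime lam z z' w w'
      & forall N : nat, (1 <= N)%N ->
          exists lam mu : {ffun 'I_N -> int},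
            [/\ GT lam, GT mu, lam <> mu,
                0 < Pprime lam z z' w w' & 0 < Pprime mu z z' w w']]].

Definition Zprinc (R : realType) : set (R[i] * R[i]) :=
  [set p | let: (z, z') := p in
    ~ (z \is Num.real /\ z' \is Num.real) /\ z' = z^*].

Definition Zcompl (R : realType) : set (R[i] * R[i]) :=
  [set p | let: (z, z') := p in
    [/\ z \is Num.real, z' \is Num.real &
      exists m : int, m%:~R < z < (m + 1)%:~R /\ m%:~R < z' < (m + 1)%:~R]].

Definition Zdegen_at (R : realType) (m : int) : set (R[i] * R[i]) :=
  [set p | let: (z, z') := p in
    [/\ z \is Num.real, z' \is Num.real &
      (z = m%:~R /\ (m - 1)%:~R < z') \/ (z' = m%:~R /\ (m - 1)%:~R < z)]].

Definition Zdegen (R : realType) : set (R[i] * R[i]) :=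
  \bigcup_(m : int) @Zdegen_at R m.

Definition Zset (R : realType) : set (R[i] * R[i]) :=
  @Zprinc R `|` @Zcompl R `|` @Zdegen R.

(* Main.v *)
Require Import Defs.
From HB Require Import structures.
From mathcomp Require Import all_boot all_order all_algebra.
From mathcomp Require Import complex.
From mathcomp Require Import all_classical all_reals all_analysis.
From mathcomp Require Import ring lra zify.
Import Order.TTheory GRing.Theory Num.Theory.
Import numFieldNormedType.Exports.
Import ComplexField.Normc.
Local Open Scope classical_set_scope.
Local Open Scope ring_scope.
Local Open Scope complex_scope.

(* With l_i = lambda_i - i, P'_N(lambda) is Dim_N(lambda)^2 times the product
   over i of A(l_i) B(N + l_i), where A(n) = 1/(Gamma(z-n) Gamma(z'-n)) and
   B(n) = 1/(Gamma(w+1+n) Gamma(w'+1+n)), and l_1 > ... > l_N are arbitrary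
   integers.  If two such N-sets carry positive weight, then at least N + 1
   points are available, so exchanging n for n - 1 in an N-set shows
     (z-n)(z'-n) / ((w+N+n)(w'+N+n)) > 0
   whenever the weights involved are nonzero.  Letting N grow with n fixed, the
   values (z-n)(z'-n) all have the same phase; their second difference is 2, so
   they are positive, which characterises membership in Z.  Conversely the
   constant signature c has l_i running over c - N, ..., c - 1, so c and c + 1
   both have positive weight once A(c) and B(c) are positive; when both pairs
   are degenerate this means -l <= c < k. *)

(** * Convergence of complex sequences *)

(** Working with real and imaginary parts makes monotone convergence and limits of inequalities over
    the reals available; [ccvg_limn] carries the result to the modulus topology used by [rGamma]. *)
Definition ccvg (R : realType) (u : nat -> R[i]) (l : R[i]) : Prop :=
  (fun n => complex.Re (u n)) @ \oo --> complex.Re l /\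
  (fun n => complex.Im (u n)) @ \oo --> complex.Im l.

Lemma sqrt_sum_sqr_le (R : realType) (x y : R) :
  Num.sqrt (x ^+ 2 + y ^+ 2) <= `|x| + `|y|.
Proof.
rewrite -(@ler_pXn2r _ 2) ?nnegrE ?sqrtr_ge0 ?addr_ge0//.
rewrite sqr_sqrtr ?addr_ge0 ?sqr_ge0// sqrrD !real_normK ?num_real//.
by rewrite lerD2r lerDl mulrn_wge0 ?mulr_ge0.
Qed.

Lemma ccvg_limn (R : realType) (u : nat -> R[i]) (l : R[i]) : ccvg R u l ->
  limn (u : nat -> (R[i] : numClosedFieldType)) = l.
Proof.
move=> [/cvgrPdist_lt cr /cvgrPdist_lt ci].
apply: (@cvg_lim (R[i] : numClosedFieldType)); first exact: norm_hausdorff.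
apply/(@cvgrPdist_lt (R[i] : numClosedFieldType)) => e e0.
have e2 : 0 < complex.Re e / 2.
  by move: e0; rewrite ltcE /= => /andP[_ h]; rewrite divr_gt0.
have eE : e = (complex.Re e)%:C.
  by move: e0; case: (e) => a b; rewrite ltcE /= => /andP[/eqP -> _].
near=> n.
have hr : `|complex.Re l - complex.Re (u n)| < complex.Re e / 2.
  by near: n; exact: cr.
have hi : `|complex.Im l - complex.Im (u n)| < complex.Re e / 2.
  by near: n; exact: ci.
rewrite normc_def eE ltcR.
apply: le_lt_trans (sqrt_sum_sqr_le _ _ _) _.
move: hr hi; case: (l) => lr li; case: (u n) => ur ui /= hr hi.
lra.
Unshelve. all: by end_near. Qed.

Lemma ccvgM (R : realType) (u v : nat -> R[i]) (a b : R[i]) :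
  ccvg R u a -> ccvg R v b -> ccvg R (fun n => u n * v n) (a * b).
Proof.
move=> [ur ui] [vr vi].
have rM (x y : R[i]) : complex.Re (x * y) =
    complex.Re x * complex.Re y - complex.Im x * complex.Im y.
  by case: x y => ? ? [].
have iM (x y : R[i]) : complex.Im (x * y) =
    complex.Re x * complex.Im y + complex.Im x * complex.Re y.
  by case: x y => ? ? [].
split.
- under eq_cvg do rewrite rM; rewrite rM.
  by apply: cvgB; apply: cvgM.
- under eq_cvg do rewrite iM; rewrite iM.
  by apply: cvgD; apply: cvgM.
Qed.

Lemma ccvgD (R : realType) (u v : nat -> R[i]) (a b : R[i]) :
  ccvg R u a -> ccvg R v b -> ccvg R (fun n => u n + v n) (a + b).
Proof.
move=> [ur ui] [vr vi]; split; rewrite raddfD.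
  by under eq_cvg do rewrite raddfD; exact: cvgD.
by under eq_cvg do rewrite raddfD; exact: cvgD.
Qed.

Lemma ccvg_shiftS (R : realType) (u : nat -> R[i]) (l : R[i]) :
  ccvg R (fun n => u n.+1) l -> ccvg R u l.
Proof. by move=> [ur ui]; split; rewrite -cvg_shiftS. Qed.

Lemma ccvg_unique (R : realType) (u : nat -> R[i]) (a b : R[i]) :
  ccvg R u a -> ccvg R u b -> a = b.
Proof.
move=> [ar ai] [br bi]; apply/eqP; rewrite eq_complex.
by rewrite (cvg_unique _ ar br) // (cvg_unique _ ai bi) // !eqxx.
Qed.

Lemma near_ccvg (R : realType) (u v : nat -> R[i]) (l : R[i]) (N : nat) :
  (forall n, (N <= n)%N -> u n = v n) -> ccvg R u l -> ccvg R v l.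
Proof.
move=> uv [ur ui]; split; [move: ur|move: ui]; apply: cvg_trans;
  by apply: near_eq_cvg; exists N => // n /= /uv ->.
Qed.

Lemma ccvg_cst (R : realType) (l : R[i]) : ccvg R (fun=> l) l.
Proof. by split; exact: cvg_cst. Qed.

Lemma ccvg_conj (R : realType) (u : nat -> R[i]) (l : R[i]) :
  ccvg R u l -> ccvg R (fun n => (u n)^*) l^*.
Proof.
have rJ (x : R[i]) : complex.Re x^* = complex.Re x by case: x.
have iJ (x : R[i]) : complex.Im x^* = - complex.Im x by case: x.
move=> [ur ui]; split; first by under eq_cvg do rewrite rJ; rewrite rJ.
by under eq_cvg do rewrite iJ; rewrite iJ; exact: cvgN.
Qed.

Lemma ccvg_ge0 (R : realType) (u : nat -> R[i]) (l : R[i]) :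
  (forall n, 0 <= u n) -> ccvg R u l -> 0 <= l.
Proof.
move=> u0 [ur ui]; rewrite lecE /=; apply/andP; split.
  have i0 : (fun n => complex.Im (u n)) = fun=> 0.
    by apply/funext => n; move: (u0 n); rewrite lecE /= => /andP[/eqP -> _].
  by move: ui; rewrite i0 => ui; rewrite (cvg_unique _ ui (cvg_cst _)).
rewrite -(cvg_lim (@norm_hausdorff _ R) ur).
apply: limr_ge; first by apply/cvg_ex; exists (complex.Re l).
by near=> n; move: (u0 n); rewrite lecE /= => /andP[_ ->].
Unshelve. all: by end_near. Qed.

(* [n.+1%:R^-1 - n.+2%:R^-1] plays the role of 1/n^2: it telescopes, so no
   summation is needed. *)
Lemma telescoping_is_cvg (R : realType) (x : R^nat) (K : R) (N : nat) :
  (forall n, (N <= n)%N -> `|x n.+1 - x n| <= K * (n.+1%:R^-1 - n.+2%:R^-1)) ->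
  cvgn x.
Proof.
move=> dx.
have K0 : 0 <= K.
  rewrite -(@pmulr_lge0 _ (N.+1%:R^-1 - N.+2%:R^-1)).
    by apply: le_trans (dx N _).
  by rewrite subr_gt0 ltf_pV2 ?posrE// ltr_nat.
(* Subtracting K/(n+1) makes the sequence nondecreasing, while adding it makes it nonincreasing; the
   latter is [ub] and supplies the upper bound for [y]. *)
pose y n := x (n + N)%N - K * (n + N).+1%:R^-1.
have ub n : x (n + N)%N + K * (n + N).+1%:R^-1 <= x N + K * N.+1%:R^-1.
  elim: n => [|n IH]; first by rewrite add0n.
  rewrite addSn; apply: le_trans IH.
  have := dx (n + N)%N (leq_addl _ _).
  rewrite ler_norml => /andP[_].
  by move: (_^-1) (_^-1) => a b; rewrite mulrBr; lra.
have cy : cvgn y.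
  apply: nondecreasing_is_cvgn.
    apply/nondecreasing_seqP => n; rewrite /y addSn.
    have := dx (n + N)%N (leq_addl _ _).
    rewrite ler_norml => /andP[+ _].
    by move: (_^-1) (_^-1) => a b; rewrite mulrBr; lra.
  exists (x N + K * N.+1%:R^-1) => _ [n _ <-]; rewrite /y.
  apply: le_trans (ub n); rewrite lerD2l (@le_trans _ _ 0)//.
    by rewrite oppr_le0 mulr_ge0.
  by rewrite mulr_ge0.
have ch : (fun n => K * (n + N).+1%:R^-1) @ \oo --> K * 0.
  apply: cvgM; first exact: cvg_cst.
  have := @cvg_harmonic R.
  by rewrite -(cvg_shiftn N).
apply/cvg_ex; exists (lim (y @ \oo) + K * 0).
rewrite -(cvg_shiftn N) /=.
rewrite (_ : (fun n => _) = y \+ (fun n => K * (n + N).+1%:R^-1)).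
  exact: cvgD.
by apply/funext => n /=; rewrite /y subrK.
Qed.

Lemma normc_ge0 (R : rcfType) (x : R[i]) : 0 <= normc x.
Proof. by case: x => a b; rewrite /= sqrtr_ge0. Qed.

Lemma normc_eq0 (R : rcfType) (x : R[i]) : (normc x == 0) = (x == 0).
Proof.
apply/eqP/eqP => [/eq0_normc//|->]; exact: normc0.
Qed.

Lemma Re_le_normc (R : rcfType) (x : R[i]) : `|complex.Re x| <= normc x.
Proof.
by case: x => a b /=; rewrite -sqrtr_sqr ler_wsqrtr// lerDl sqr_ge0.
Qed.

Lemma Im_le_normc (R : rcfType) (x : R[i]) : `|complex.Im x| <= normc x.
Proof.
by case: x => a b /=; rewrite -sqrtr_sqr ler_wsqrtr// lerDr sqr_ge0.
Qed.

(** Since 1 + x <= exp x, the products |a_n| exp(C/(n+1)) are nonincreasing from [N] on. So the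
    sequence is bounded by some [M], and the relative estimate becomes an absolute one with constant
    C M, to which [telescoping_is_cvg] applies. *)
Lemma ratio_ccvg (R : realType) (a : nat -> R[i]) (C : R) (N : nat) :
  0 <= C ->
  (forall n, (N <= n)%N ->
    normc (a n.+1 - a n) <= C * (n.+1%:R^-1 - n.+2%:R^-1) * normc (a n)) ->
  exists l, ccvg R a l.
Proof.
move=> C0 da.
pose M := normc (a N) * expR (C * N.+1%:R^-1).
have bd n : normc (a (n + N)%N) * expR (C * (n + N).+1%:R^-1) <= M.
  elim: n => [|n IH]; first by rewrite add0n.
  rewrite addSn; apply: le_trans IH.
  have := da (n + N)%N (leq_addl _ _).
  set m := (n + N)%N; move: (m.+1%:R^-1) (m.+2%:R^-1) => h k le_da.
  have le_a : normc (a m.+1) <= expR (C * (h - k)) * normc (a m).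
    have := le_normcD (a m.+1 - a m) (a m); rewrite subrK => /le_trans; apply.
    apply: le_trans (_ : (1 + C * (h - k)) * normc (a m) <= _).
      by rewrite mulrDl mul1r addrC lerD2l.
    by rewrite ler_wpM2r ?normc_ge0// expR_ge1Dx.
  apply: le_trans (_ : expR (C * (h - k)) * normc (a m) * expR (C * k) <= _).
    by rewrite ler_wpM2r ?expR_ge0.
  by rewrite mulrC mulrA -expRD mulrC -mulrDr addrC subrK.
have bd' n : (N <= n)%N -> normc (a n) <= M.
  move=> Nn; have := bd (n - N)%N; rewrite subnK// => /(le_trans _); apply.
  rewrite ler_peMr ?normc_ge0//; apply: le_trans (expR_ge1Dx _).
  by rewrite lerDl mulr_ge0.
have dM n : (N <= n)%N ->
    normc (a n.+1 - a n) <= (C * M) * (n.+1%:R^-1 - n.+2%:R^-1).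
  move=> Nn; apply: le_trans (da n Nn) _.
  rewrite mulrAC ler_wpM2r//; last by rewrite ler_wpM2l// bd'.
  by rewrite subr_ge0 lef_pV2 ?posrE// ler_nat.
have cr : cvgn (fun n => complex.Re (a n)).
  apply: (@telescoping_is_cvg _ _ (C * M) N) => n /dM; apply: le_trans.
  by rewrite -raddfB; exact: Re_le_normc.
have ci : cvgn (fun n => complex.Im (a n)).
  apply: (@telescoping_is_cvg _ _ (C * M) N) => n /dM; apply: le_trans.
  by rewrite -raddfB; exact: Im_le_normc.
by exists (lim ((fun n => complex.Re (a n)) @ \oo) +i*
           lim ((fun n => complex.Im (a n)) @ \oo)); split.
Qed.

(* The reciprocals satisfy the same kind of ratio estimate, hence converge, and
   a limit with an inverse is nonzero. *)
Lemma ratio_ccvg_neq0 (R : realType) (a : nat -> R[i]) (C : R) (N : nat) :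
  0 <= C -> (forall n, a n != 0) ->
  (forall n, (N <= n)%N ->
    normc (a n.+1 - a n) <= C * (n.+1%:R^-1 - n.+2%:R^-1) * normc (a n)) ->
  exists2 l, l != 0 & ccvg R a l.
Proof.
move=> C0 a0 da.
have [l al] := @ratio_ccvg _ _ _ _ C0 da.
(* From [N1] on the relative increment is at most 1/2, hence |a_n| <= 2 |a_(n+1)|; this is the
   factor 2 in the constant for the reciprocals. *)
have [N1 N1C] : exists N1 : nat, 2 * C <= N1%:R.
  by exists (Num.bound (2 * C)); rewrite ltW// archi_boundP// mulr_ge0.
have [||l' al'] := @ratio_ccvg _ (fun n => (a n)^-1) (2 * C) (maxn N N1).
- by rewrite mulr_ge0.
- move=> n; rewrite geq_max => /andP[Nn N1n].
  have an : 0 < normc (a n) by rewrite lt_def normc_ge0 normc_eq0 a0.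
  have an1 : 0 < normc (a n.+1) by rewrite lt_def normc_ge0 normc_eq0 a0.
  have := da n Nn.
  have hk : 2 * C * (n.+1%:R^-1 - n.+2%:R^-1) <= 1.
    apply: (@le_trans _ _ (n.+1%:R * (n.+1%:R^-1 - n.+2%:R^-1))).
      rewrite ler_wpM2r//; first by rewrite subr_ge0 lef_pV2 ?posrE// ler_nat.
      by rewrite (le_trans N1C)// ler_nat leqW.
    rewrite mulrBr divff ?pnatr_eq0// gerBl.
  have hk0 : 0 <= n.+1%:R^-1 - n.+2%:R^-1 :> R.
    by rewrite subr_ge0 lef_pV2 ?posrE// ler_nat.
  move: hk hk0; set d := (_ - _ in X in _ -> X -> _) => hk hk0 le_da.
  have le_a : normc (a n) <= 2 * normc (a n.+1).
    have le3 : normc (a n) <= normc (a n.+1) + normc (a n.+1 - a n).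
      rewrite -(normcN (a n.+1 - a n)) opprB -[X in normc X](subrK (a n.+1)).
      by rewrite addrC; exact: le_normcD.
    have := ler_piMl (ltW an) hk.
    move: le_da le3; rewrite -!mulrA; move: (C * _) (normc _) => P X; lra.
  rewrite (_ : (a n.+1)^-1 - (a n)^-1 =
    - ((a n.+1 - a n) * ((a n)^-1 * (a n.+1)^-1))); last first.
    by field; rewrite !a0.
  rewrite normcN !normcM !normcV [leRHS]mulrC [leLHS]mulrCA.
  rewrite ler_pM2l ?invr_gt0// ler_pdivrMr//; apply: le_trans le_da _.
  rewrite (_ : 2 * C * d * _ = C * d * (2 * normc (a n.+1))); last by ring.
  by rewrite ler_wpM2l// mulr_ge0.
exists l => //; apply/eqP => l0.
have := ccvgM _ _ _ _ _ al al'; rewrite l0 mul0r.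
rewrite (_ : (fun n => _) = fun=> 1); last by apply/funext => n; rewrite divff.
by move=> /(ccvg_unique _ _ _ _ (ccvg_cst _ 1))/eqP; rewrite oner_eq0.
Qed.

(** * The reciprocal Gamma function *)

Lemma MVT_origin (R : realType) (f df : R -> R) (y : R) :
  (forall x : R, is_derive x 1 f (df x)) ->
  exists2 c, `|c| <= `|y| & f y - f 0 = df c * y.
Proof.
move=> fd.
have cf a b : {within `[a, b], continuous f}.
  apply: continuous_subspaceT => x.
  apply/differentiable_continuous/derivable1_diffP; by have ? := fd x; apply: ex_derive.
have [y0|/ltW y0] := leP 0 y.
  have [c /andP[c0 cy] ->] := MVT_segment y0 (fun x _ => fd x) (cf _ _).
  exists c; last by rewrite subr0.
  by rewrite !ger0_norm.
have [c /andP[c0 cy] /eqP] := MVT_segment y0 (fun x _ => fd x) (cf _ _).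
rewrite -(inj_eq oppr_inj) opprB sub0r mulrN opprK => /eqP ->.
by exists c => //; rewrite !ler0_norm// lerN2.
Qed.

Lemma sin_le_id (R : realType) (y : R) : `|sin y| <= `|y|.
Proof.
have [c _] := MVT_origin R sin cos y (fun x => is_derive_sin x).
by rewrite sin0 subr0 => ->; rewrite normrM ler_piMl// cos_max.
Qed.

Lemma one_sub_cos_le (R : realType) (y : R) :
  `|cos y - 1| <= `|y| /\ `|cos y - 1| <= y ^+ 2.
Proof.
have [c cy] := MVT_origin R cos (fun x => - sin x) y
  (fun x => is_derive_cos x).
rewrite cos0 => ->; rewrite mulNr normrN normrM; split.
  by rewrite ler_piMl// sin_max.
rewrite -real_normK ?num_real// expr2 ler_wpM2r//.
exact: le_trans (sin_le_id _ _) cy.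
Qed.

Lemma sin_sub_id_le (R : realType) (y : R) : `|sin y - y| <= y ^+ 2.
Proof.
have d (x : R) : is_derive x 1 (fun x => sin x - x) (cos x - 1).
  exact: is_deriveB.
have [c cy] := MVT_origin _ _ _ y d.
rewrite sin0 !subr0 => ->; rewrite normrM -real_normK ?num_real// expr2.
by rewrite ler_wpM2r//; apply: le_trans (one_sub_cos_le _ _).1 cy.
Qed.

(** From exp(-x) >= 1 - x one gets exp(x) (1 - x) <= 1, so exp(x) - 1 - x <= x^2 / (1 - x), and 1 -
    x >= 1/2. *)
Lemma expR_taylor1_le (R : realType) (x : R) : `|x| <= 2^-1 ->
  `|expR x - 1 - x| <= 2 * x ^+ 2.
Proof.
rewrite ler_norml => /andP[x1 x2].
have h1 := expR_ge1Dx x.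
have h2 := expR_ge1Dx (- x).
have h3 := expRxMexpNx_1 x.
have h4 := expR_gt0 x.
rewrite ger0_norm; last lra.
have : expR x * (1 - x) <= 1 by rewrite -[leRHS]h3 ler_wpM2l// ltW.
nra.
Qed.

Lemma cexp_taylor1_le (R : realType) (u : R[i]) : normc u <= 2^-1 ->
  normc (cexp u - 1 - u) <= 8 * normc u ^+ 2.
Proof.
move=> u2.
have x2 := le_trans (Re_le_normc _ u) u2.
have -> : normc u ^+ 2 = complex.Re u ^+ 2 + complex.Im u ^+ 2.
  by case: (u) => x y /=; rewrite sqr_sqrtr// addr_ge0 ?sqr_ge0.
move: x2; case: (u) => x y /= x2; rewrite /cexp /=.
apply: le_trans (sqrt_sum_sqr_le _ _ _) _; rewrite /= !(mul0r, subr0, add0r, addr0).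
have e1 := expR_taylor1_le _ _ x2.
have s1 := sin_le_id _ y.
have [_ c1] := one_sub_cos_le _ y.
have s2 := sin_sub_id_le _ y.
move: e1 s1 c1 s2 (expR_gt0 x) (sin_max y); move: (expR x) (cos y) (sin y) => e c s.
move=> e1 s1 c1 s2 e0 sm.
have e2 : e <= 2.
  by move: e1 x2; rewrite !ler_norml => /andP[? ?] /andP[? ?]; nra.
(* Every summand of the two components is quadratically small; together they contribute at most 5
   x^2 + 4 y^2. *)
have -> : e * c - 1 - x = (e - 1 - x) + e * (c - 1) by ring.
have -> : e * s - y = (e - 1 - x) * s + x * s + (s - y) by ring.
have b1 := ler_normD (e - 1 - x) (e * (c - 1)).
have b2 := ler_normD ((e - 1 - x) * s + x * s) (s - y).
have b3 := ler_normD ((e - 1 - x) * s) (x * s).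
have b4 : `|(e - 1 - x) * s| <= 2 * x ^+ 2.
  rewrite normrM; by apply: le_trans e1; rewrite ler_piMr.
have b5 : `|e * (c - 1)| <= 2 * y ^+ 2.
  by rewrite normrM (gtr0_norm e0) ler_pM// ltW.
have b6 : `|x * s| <= x ^+ 2 + y ^+ 2.
  rewrite normrM; apply: le_trans (_ : `|x| * `|y| <= _).
    by rewrite ler_wpM2l.
  rewrite -(real_normK (num_real x)) -(real_normK (num_real y)).
  by have := sqr_ge0 (`|x| - `|y|); have := sqr_ge0 (`|x| + `|y|); lra.
have := sqr_ge0 x; have := sqr_ge0 y.
lra.
Qed.

Lemma cexpD (R : realType) (u v : R[i]) : cexp (u + v) = cexp u * cexp v.
Proof.
case: u v => a b [c d]; rewrite /cexp /= expRD cosD sinD.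
by apply/eqP; rewrite eq_complex /=; apply/andP; split; apply/eqP; ring.
Qed.

Lemma cexp_real (R : realType) (x : R) : cexp x%:C = (expR x)%:C.
Proof. by rewrite /cexp /= cos0 sin0 mulr1. Qed.

Lemma cexp_neq0 (R : realType) (u : R[i]) : cexp u != 0.
Proof.
apply/eqP => u0; have := cexpD _ u (- u).
rewrite subrr u0 mul0r (cexp_real _ 0) expR0.
by move/eqP; rewrite oner_eq0.
Qed.

Lemma cexp_conj (R : realType) (u : R[i]) : cexp u^* = (cexp u)^*.
Proof.
case: u => a b; rewrite /cexp /= cosN sinN.
by apply/eqP; rewrite eq_complex /=; apply/andP; split; apply/eqP; ring.
Qed.

(** * Convergence of Gauss's sequence and zeros of its limit *)

Lemma ln_succ_bounds (R : realType) (n : nat) :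
  n.+2%:R^-1 <= ln (n.+2%:R : R) - ln n.+1%:R <= n.+1%:R^-1.
Proof.
rewrite -ln_div ?posrE//; apply/andP; split; last first.
  rewrite (_ : n.+2%:R / n.+1%:R = 1 + n.+1%:R^-1 :> R).
    by apply: le_ln1Dx; apply: lt_trans (_ : 0 < _); rewrite ?invr_gt0.
  by rewrite -natr1 mulrDl divff ?pnatr_eq0// mul1r.
(* The lower bound is again ln(1 + x) <= x, now for the inverse quotient with x = -1/(n+2). *)
rewrite -[leRHS]opprK -lnV ?posrE ?divr_gt0// invf_div lerNr.
rewrite (_ : n.+1%:R / n.+2%:R = 1 + (- n.+2%:R^-1) :> R).
  apply: le_ln1Dx; rewrite ltrN2 invf_lt1 ?ltr1n//.
have n0 : n.+2%:R != 0 :> R by rewrite pnatr_eq0.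
apply: (mulIf n0); rewrite divfK// mulrDl mul1r mulNr mulVf//.
by rewrite -(natr1 n.+1) addrK.
Qed.

(** The recursion starts at index 1, since at index 0 [ln] returns a default value. *)
Lemma rGamma_seqS (R : realType) (s : R[i]) (n : nat) :
  rGamma_seq s n.+2 = rGamma_seq s n.+1 *
    ((1 + s * (n.+2%:R^-1)%:C) *
     cexp (- (s * (ln n.+2%:R - ln n.+1%:R)%:C))).
Proof.
rewrite /rGamma_seq big_ord_recr /= factS natrM.
have -> : cexp (s * (ln n.+2%:R)%:C) = cexp (s * (ln n.+1%:R)%:C) *
    cexp (s * (ln n.+2%:R - ln n.+1%:R)%:C) :> R[i].
  by rewrite -cexpD -mulrDr -rmorphD addrC subrK.
have e1 (u : R[i]) : cexp (- u) = (cexp u)^-1.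
  apply: (mulfI (cexp_neq0 R u)); rewrite -cexpD subrr (cexp_real _ 0) expR0.
  by rewrite divff// cexp_neq0.
rewrite e1 -[(n.+2%:R^-1)%:C]/(real_complex R n.+2%:R^-1) fmorphV /= rmorph_nat.
field.
have f0 : (n.+1)`!%:R != 0 :> R[i] by rewrite pnatr_eq0 -lt0n fact_gt0.
by rewrite !cexp_neq0 f0 -natrD pnatr_eq0.
Qed.

(** With h = 1/(n+2) and t = ln(n+2) - ln(n+1), the successive quotient is (1 + s h) exp(-s t). As t
    = h + O(h^2), the first-order terms cancel and the quotient is 1 + O(h^2). *)
Lemma rGamma_seq_ratio (R : realType) (s : R[i]) :
  exists2 C : R, 0 <= C & exists N : nat, forall n, (N <= n)%N ->
    normc (rGamma_seq s n.+2 - rGamma_seq s n.+1) <=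
      C * (n.+1%:R^-1 - n.+2%:R^-1) * normc (rGamma_seq s n.+1).
Proof.
pose q : R := normc s.
have q0 : 0 <= q by exact: normc_ge0.
(* The three summands bound s (h - t), s^2 h t and (1 + s h) times the Taylor remainder of the
   exponential; 32 is 8 * 2^2, from t <= 2 h. *)
pose C0 := 2 * q + 2 * q ^+ 2 + (1 + q) * (32 * q ^+ 2).
have C00 : 0 <= C0 by rewrite !addr_ge0// mulr_ge0// ?addr_ge0// mulr_ge0 ?sqr_ge0.
exists C0 => //.
(* This [N] ensures |s t| <= 2 q h <= 1/2, as [cexp_taylor1_le] requires. *)
have [N Nq] : exists N : nat, 4 * q <= N%:R.
  by exists (Num.bound (4 * q)); rewrite ltW// archi_boundP// mulr_ge0.
exists N => n Nn; rewrite rGamma_seqS.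
rewrite -[X in normc (_ - X)]mulr1 -mulrBr normcM mulrC ler_wpM2r ?normc_ge0//.
have /andP[] := ln_succ_bounds R n.
set t := ln _ - ln _.
have ht : n.+1%:R^-1 - n.+2%:R^-1 = n.+1%:R^-1 * n.+2%:R^-1 :> R.
  have n1 : n.+1%:R != 0 :> R by rewrite pnatr_eq0.
  have n2 : n.+2%:R != 0 :> R by rewrite pnatr_eq0.
  by rewrite -[LHS](mulfK (mulf_neq0 n1 n2)) mulrBl mulKf// mulrCA mulVf// mulr1
    -(natr1 n.+1) addrAC subrr add0r mul1r invfM.
have hq : 4 * q * n.+2%:R^-1 <= 1.
  rewrite ler_pdivrMr ?mul1r//; apply: le_trans Nq _.
  by rewrite ler_nat; apply: leq_trans Nn _; rewrite -addn2 leq_addr.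
rewrite ht.
have : n.+1%:R^-1 <= 2 * n.+2%:R^-1 :> R.
  rewrite ler_pdivlMr// mulrC ler_pdivrMr// -natrM ler_nat; lia.
have : n.+2%:R^-1 <= n.+1%:R^-1 :> R by rewrite lef_pV2 ?posrE// ler_nat.
have : 0 < n.+2%:R^-1 :> R by rewrite invr_gt0.
move: ht hq; move: (n.+1%:R^-1) (n.+2%:R^-1) => k h ht hq h0 hk k2h h_t t_k.
have t0 : 0 <= t by lra.
set e := cexp _.
have nst : normc (s * t%:C) = q * t.
  rewrite normcM [normc t%:C](_ : _ = t)//=.
  by rewrite expr0n addr0 sqrtr_sqr ger0_norm//; lra.
have e_le : normc (e - 1 + s * t%:C) <= 32 * q ^+ 2 * h ^+ 2.
  have := @cexp_taylor1_le _ (- (s * t%:C)); rewrite normcN nst opprK -/e.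
  have qt : q * t <= 2 * (q * h) by nra.
  move=> /(_ ltac:(lra))/le_trans; apply.
  have : (q * t) ^+ 2 <= (2 * (q * h)) ^+ 2.
    by rewrite !expr2 ler_pM// mulr_ge0.
  lra.
have -> : (1 + s * h%:C) * e - 1 = s * (h - t)%:C - s ^+ 2 * (h * t)%:C +
    (1 + s * h%:C) * (e - 1 + s * t%:C).
  by rewrite rmorphB rmorphM /=; ring.
have nr (x : R) : normc x%:C = `|x| by rewrite /= expr0n addr0 sqrtr_sqr.
apply: le_trans (le_normcD _ _) _; rewrite normcM.
have b1 : normc (s * (h - t)%:C - s ^+ 2 * (h * t)%:C) <=
    2 * q * h ^+ 2 + 2 * q ^+ 2 * h ^+ 2.
  apply: le_trans (le_normcD _ _) _; rewrite normcN !normcM !nr -/q.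
  have -> : `|h - t| = t - h by rewrite ler0_norm; lra.
  have -> : `|h * t| = h * t by rewrite ger0_norm// mulr_ge0// ltW.
  have l1 : t - h <= 2 * h ^+ 2 by nra.
  have l2 : h * t <= 2 * h ^+ 2 by nra.
  have -> : 2 * q * h ^+ 2 = q * (2 * h ^+ 2) by ring.
  have -> : 2 * q ^+ 2 * h ^+ 2 = q * q * (2 * h ^+ 2) by ring.
  by rewrite lerD// ler_wpM2l// mulr_ge0.
have b2 : normc (1 + s * h%:C) <= 1 + q.
  apply: le_trans (le_normcD _ _) _; rewrite normc1 lerD2l normcM nr -/q.
  by rewrite ler_piMr// ger0_norm ?ltW//; nra.
have b3 : normc (1 + s * h%:C) * normc (e - 1 + s * t%:C) <=
    (1 + q) * (32 * q ^+ 2 * h ^+ 2) by rewrite ler_pM ?normc_ge0.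
apply: le_trans (lerD b1 b3) _.
rewrite [leLHS](_ : _ = C0 * (h * h)); last by rewrite /C0; ring.
by rewrite ler_wpM2l// ler_wpM2r// ltW.
Qed.

Lemma rGamma_cvg_opp_nat (R : realType) (k : nat) :
  ccvg R (rGamma_seq (- k%:R)) 0.
Proof.
apply: (near_ccvg _ (fun=> 0) _ _ k) (ccvg_cst _ _) => n kn.
by rewrite /rGamma_seq (bigD1 (Ordinal (kn : (k < n.+1)%N)))//= addNr !mul0r.
Qed.

Lemma rGamma_cvg_neq0 (R : realType) (s : R[i]) :
  (forall k : nat, s != - k%:R) ->
  exists2 l, l != 0 & ccvg R (rGamma_seq s) l.
Proof.
move=> sk; have [C C0 [N da]] := rGamma_seq_ratio _ s.
have a0 n : rGamma_seq s n.+1 != 0.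
  rewrite /rGamma_seq mulf_neq0//.
    by apply/prodf_neq0 => i _; rewrite addr_eq0.
  by rewrite invr_eq0 mulf_neq0 ?cexp_neq0// pnatr_eq0 -lt0n fact_gt0.
by have [l l0 /ccvg_shiftS sl] := ratio_ccvg_neq0 _ _ _ _ C0 a0 da; exists l.
Qed.

Lemma rGamma_cvg (R : realType) (s : R[i]) : ccvg R (rGamma_seq s) (rGamma s).
Proof.
rewrite /rGamma; have [[k ->]|sk] := pselect (exists k : nat, s = - k%:R).
  by rewrite (ccvg_limn _ _ _ (rGamma_cvg_opp_nat _ k)); exact: rGamma_cvg_opp_nat.
have [|l _ sl] := rGamma_cvg_neq0 _ s; last by rewrite (ccvg_limn _ _ _ sl).
by move=> k; apply/eqP => sE; apply: sk; exists k.
Qed.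

Lemma rGamma_eq0 (R : realType) (s : R[i]) :
  rGamma s = 0 <-> exists k : nat, s = - k%:R.
Proof.
split=> [s0|[k ->]]; last exact: ccvg_limn (rGamma_cvg_opp_nat _ k).
apply: contrapT => sk; have [|l /eqP l0 sl] := rGamma_cvg_neq0 _ s.
  by move=> k; apply/eqP => sE; apply: sk; exists k.
by apply: l0; rewrite (ccvg_unique _ _ _ _ sl (rGamma_cvg _ s)).
Qed.

(** * Functional equation, conjugation and positivity of 1/Gamma *)

Lemma rGamma_rec (R : realType) (s : R[i]) : rGamma s = s * rGamma (s + 1).
Proof.
have h := ccvgM _ _ _ _ _ (rGamma_cvg _ (s + 1)) (ccvg_cst _ s).
rewrite mulrC; apply: ccvg_unique h.
(* For n >= 1, s times the n-th term for s + 1 is the n-th term for s times 1 + (s+1)/n, and this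
   factor tends to 1. *)
have c1 : ccvg R (fun n => 1 + (s + 1) * (n%:R^-1)%:C) (1 + (s + 1) * 0%:C).
  apply: (ccvg_shiftS _ (fun n => 1 + (s + 1) * (n%:R^-1)%:C)).
  apply: ccvgD (ccvg_cst _ _) (ccvgM _ _ _ _ _ (ccvg_cst _ _) _).
  by split => /=; [exact: cvg_harmonic|exact: cvg_cst].
rewrite mulr0 addr0 in c1.
have := ccvgM _ _ _ _ _ (rGamma_cvg _ s) c1; rewrite mulr1.
apply: (near_ccvg _ _ _ _ 1) => -[//|n] _.
rewrite /rGamma_seq big_ord_recl [in RHS]big_ord_recr /= addr0.
have -> : cexp ((s + 1) * (ln n.+1%:R)%:C) =
    cexp (s * (ln n.+1%:R)%:C) * n.+1%:R :> R[i].
  by rewrite mulrDl mul1r cexpD cexp_real lnK ?posrE// rmorph_nat.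
have -> : \prod_(i < n.+1) (s + 1 + i%:R) =
    \prod_(i < n.+1) (s + (lift ord0 i)%:R) :> R[i].
  by apply: eq_bigr => i _; rewrite -addrA nat1r lift0.
rewrite -[(n.+1%:R^-1)%:C]/(real_complex R n.+1%:R^-1) fmorphV /= rmorph_nat.
have f0 : (n.+1)`!%:R != 0 :> R[i] by rewrite pnatr_eq0 -lt0n fact_gt0.
field.
by rewrite cexp_neq0 f0 nat1r pnatr_eq0.
Qed.

Lemma rGamma_conj (R : realType) (s : R[i]) : rGamma s^* = (rGamma s)^*.
Proof.
apply: ccvg_unique (rGamma_cvg _ _) _.
rewrite (_ : rGamma_seq _ = fun n => (rGamma_seq s n)^*).
  exact/ccvg_conj/rGamma_cvg.
apply/funext => n; rewrite /rGamma_seq fmorph_div rmorphM rmorph_nat rmorph_prod.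
have -> : cexp (s^* * (ln n%:R)%:C) = (cexp (s * (ln n%:R)%:C))^*.
  by rewrite -cexp_conj rmorphM /= oppr0.
by congr (_ / _); apply: eq_bigr => i _; rewrite rmorphD rmorph_nat.
Qed.

Lemma rGamma_gt0 (R : realType) (s : R[i]) : 0 < s -> 0 < rGamma s.
Proof.
move=> s0; rewrite lt_def; apply/andP; split.
  apply/eqP => /rGamma_eq0[k sk]; move: s0; rewrite sk oppr_gt0.
  by rewrite ltrn0.
apply: ccvg_ge0 (rGamma_cvg _ s) => n.
rewrite /rGamma_seq divr_ge0//.
  by apply: prodr_ge0 => i _; rewrite addr_ge0 ?ler0n// ltW.
have /complex_realP[x ->] : s \is Num.real by rewrite realE ltW.
by rewrite -rmorphM cexp_real mulr_ge0 ?ler0n// ler0c expR_ge0.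
Qed.

(** * Pairs of reciprocal Gamma factors *)

(** This is A of the header. B is the same function of (w, w') at a reflected argument, so both
    pairs are handled by the same lemmas. *)
Definition rGamma2 (R : realType) (z z' : R[i]) (n : int) : R[i] :=
  rGamma (z - n%:~R) * rGamma (z' - n%:~R).

Definition quad (R : realType) (z z' : R[i]) (n : int) : R[i] :=
  (z - n%:~R) * (z' - n%:~R).

Lemma rGamma2C (R : realType) (z z' : R[i]) : rGamma2 R z z' = rGamma2 R z' z.
Proof. by apply/funext => n; rewrite /rGamma2 mulrC. Qed.

Lemma rGamma2_rec (R : realType) (z z' : R[i]) (n : int) :
  rGamma2 R z z' n = quad R z z' n * rGamma2 R z z' (n - 1).
Proof.
rewrite /rGamma2 rGamma_rec [rGamma (z' - _)]rGamma_rec mulrACA; congr (_ * _).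
by rewrite rmorphB /= !opprB !addrA ![_ + 1]addrC !addrA ![1 + _]addrC.
Qed.

Lemma rGamma2_neq0_down (R : realType) (z z' : R[i]) (m n : int) : m <= n ->
  rGamma2 R z z' n != 0 -> rGamma2 R z z' m != 0.
Proof.
move=> mn; have [k ->] : exists k : nat, n = m + k%:Z.
  by exists `|n - m|%N; lia.
elim: k {mn} => [|k IH]; first by rewrite addr0.
rewrite rGamma2_rec mulf_eq0 negb_or => /andP[_].
by rewrite (_ : _ - 1 = m + k%:Z); [exact: IH|lia].
Qed.

Lemma complex_intE (R : realType) (n : int) : n%:~R = (n%:~R)%:C :> R[i].
Proof. by rewrite rmorph_int. Qed.

Lemma rGamma_neq0 (R : realType) (s : R[i]) :
  (forall k : nat, s != - k%:R) -> rGamma s != 0.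
Proof.
by move=> h; apply/eqP => /rGamma_eq0[k sk]; move: (h k); rewrite sk eqxx.
Qed.

Lemma rGamma2_eq0 (R : realType) (z z' : R[i]) (n : int) :
  rGamma2 R z z' n = 0 ->
  exists2 m : int, m <= n & z = m%:~R \/ z' = m%:~R.
Proof.
have h (s : R[i]) : rGamma (s - n%:~R) = 0 ->
    exists2 m : int, m <= n & s = m%:~R.
  move=> /rGamma_eq0[k /eqP]; rewrite subr_eq => /eqP ->.
  by exists (n - k%:Z); [lia|rewrite rmorphB /= addrC].
move/eqP; rewrite mulf_eq0 => /orP[] /eqP/h[m mn sm]; exists m => //;
  by [left|right].
Qed.

(** Far to the left both z - n and z' - n have large positive real part: no zero of 1/Gamma is met,
    and the product of the real parts exceeds that of the imaginary parts. *)
Lemma quad_far (R : realType) (z z' : R[i]) :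
  exists n0 : int, forall n, n <= n0 ->
    rGamma2 R z z' n != 0 /\ 0 < complex.Re (quad R z z' n).
Proof.
case: z z' => a b [c d].
have [M Mh] : exists M : nat, `|a| + `|b| + `|c| + `|d| + 1 <= M%:R.
  exists (Num.bound (`|a| + `|b| + `|c| + `|d| + 1)).
  by rewrite ltW// archi_boundP// !addr_ge0.
exists (- M%:Z) => n nM.
have nM' : n%:~R <= - M%:R :> R.
  by rewrite -(ler_int R) rmorphN /= in nM.
have := ler_norm (- a); have := ler_norm (- c); rewrite !normrN => h1 h2.
have h3 := normr_ge0 a; have h4 := normr_ge0 b.
have h5 := normr_ge0 c; have h6 := normr_ge0 d.
split.
  apply/eqP => /rGamma2_eq0 [m mn].
  have mn' : m%:~R <= n%:~R :> R by rewrite ler_int.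
  by rewrite complex_intE => -[] [? _]; lra.
rewrite /quad complex_intE /= !subr0.
have : `|b * d| <= `|b| * `|d| by rewrite normrM.
have := ler_norm (b * d); nra.
Qed.

(* The second difference of [quad] is 2, so a common phase of three consecutive
   values must be real, and its sign is read off far to the left. *)
Lemma quad_gt0 (R : realType) (z z' w w' : R[i]) :
  (forall n m, rGamma2 R z z' n != 0 -> rGamma2 R w w' m != 0 -> n + m <= -1 ->
    0 < quad R z z' n / quad R w w' m) ->
  forall n, rGamma2 R z z' n != 0 -> 0 < quad R z z' n.
Proof.
move=> h n An.
have [n0 far] := quad_far _ z z'; have [m0 far'] := quad_far _ w w'.
(* One [m] serves all k <= n: it is left enough for [rGamma2 w w' m] to be nonzero and for k + m <=
   -1. Thus [c] carries the common phase. *)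
pose m := Num.min m0 (- 1 - n).
have Am : rGamma2 R w w' m != 0 by apply: (far' _ _).1; rewrite /m ge_min lexx.
set c := quad R w w' m.
have hc k : k <= n -> 0 < quad R z z' k / c.
  move=> kn; apply: h => //; first exact: rGamma2_neq0_down An.
  have : m <= - 1 - n by rewrite /m ge_min lexx orbT.
  lia.
have c0 : c != 0.
  by apply/eqP => c0; have := hc n (lexx _); rewrite c0 invr0 mulr0 ltxx.
have cr : c^-1 \is Num.real.
  have -> : c^-1 = (quad R z z' n / c - quad R z z' (n - 1) / c *+ 2 +
      quad R z z' (n - 2) / c) / 2.
    by rewrite /quad !rmorphB /=; field; rewrite c0.
  have r1 := gtr0_real (hc n (lexx _)).
  have r2 : quad R z z' (n - 1) / c \is Num.real.
    by apply/gtr0_real/hc; lia.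
  have r3 : quad R z z' (n - 2) / c \is Num.real.
    by apply/gtr0_real/hc; lia.
  by rewrite realM ?realV ?realn// realD// realB// mulr2n realD.
pose k := Num.min n0 n.
have kn : k <= n by rewrite /k ge_min lexx orbT.
have [_ qk] : rGamma2 R z z' k != 0 /\ 0 < complex.Re (quad R z z' k).
  by apply: far; rewrite /k ge_min lexx.
suff ci : 0 < c^-1 by have := hc n (lexx _); rewrite pmulr_lgt0.
have := hc k kn; move/complex_realP: cr qk => [x ->].
case: (quad R z z' k) => u v; rewrite !ltcE /= eqxx /= => u0.
rewrite !mulr0 subr0 => /andP[_].
by rewrite pmulr_rgt0.
Qed.

Lemma Zset_of_quad_gt0 (R : realType) (z z' : R[i]) :
  (forall n, rGamma2 R z z' n != 0 -> 0 < quad R z z' n) -> Zset (z, z').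
Proof.
move=> h; have [n0 far] := quad_far _ z z'.
have q0 := h _ (far _ (lexx n0)).1.
have q1 : 0 < quad R z z' (n0 - 1) by apply/h/(far _ _).1; lia.
(* The value at n is z z' - n (z + z') + n^2; its being real at two consecutive n makes sum and
   product real. So z, z' are both real or conjugate. *)
have [s_im p_im] : complex.Im (z + z') = 0 /\ complex.Im (z * z') = 0.
  move: q0 q1; rewrite /quad !complex_intE rmorphB /=.
  case: (z) (z') => a b [c d]; rewrite !ltcE /=. rewrite !subr0.
  move=> /andP[/eqP e1 _] /andP[/eqP e2 _].
  have bd : b + d = 0 by lra.
  have : n0%:~R * (b + d) = 0 by rewrite bd mulr0.
  by split; lra.
have [zr|znr] := boolP (z \is Num.real); last first.
  left; left; split; first by case=> zr; rewrite zr in znr.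
  move: s_im p_im znr; case: (z) (z') => a b [c d] /=.
  rewrite complex_real => e1 e2 b0.
  apply/eqP; rewrite eq_complex /=; apply/andP; split; apply/eqP; last lra.
  have d_eq : d = - b by lra.
  apply: (mulfI b0).
  by move: e2; rewrite d_eq; lra.
have z'r : z' \is Num.real.
  move: s_im zr; case: (z) (z') => a b [c d] /=; rewrite !complex_real.
  by move=> + /eqP b0; rewrite b0 add0r => ->.
(* Test at n = m - 1, where the factor u - n is 1. If the weight there is nonzero, then u' > m - 1.
   Otherwise u' is an integer m' <= m - 1, and the pair is degenerate at m' instead. *)
have degen (u u' : R[i]) (m : int) : u' \is Num.real ->
    (forall n, rGamma2 R u u' n != 0 -> 0 < quad R u u' n) -> u = m%:~R ->
    (m - 1)%:~R < u' \/ exists2 m' : int, u' = m'%:~R & (m' - 1)%:~R < u.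
  move=> u'r hu um; have [/rGamma2_eq0 [m' m'm]|] := eqVneq (rGamma2 R u u' (m - 1)) 0.
    rewrite um => -[/intr_inj mm|->]; first by move: m'm; rewrite mm; lia.
    by right; exists m' => //; rewrite ltr_int; lia.
  move=> /hu; rewrite /quad um -rmorphB /= opprB addrCA subrr addr0 mul1r subr_gt0.
  by left.
have [[m zm]|z_nint] := pselect (exists m : int, z = m%:~R).
  right; have [zz'|[m' z'm' zz']] := degen z z' m z'r h zm.
    by exists m => //; split => //; left.
  by exists m' => //; split => //; right.
have [[m z'm]|z'_nint] := pselect (exists m : int, z' = m%:~R).
  have h' n : rGamma2 R z' z n != 0 -> 0 < quad R z' z n.
    by rewrite rGamma2C /quad mulrC; exact: h.
  right; have [zz'|[m' zm' zz']] := degen z' z m zr h' z'm.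
    by exists m => //; split => //; right.
  by exists m' => //; split => //; left.
left; right; split => //.
have hq n : 0 < quad R z z' n.
  apply/h/eqP => /rGamma2_eq0[m _ []] zE; [apply: z_nint|apply: z'_nint];
    by exists m.
move/complex_realP: zr z'r => [x zx] /complex_realP[y zy].
have hr n : 0 < (x - n%:~R) * (y - n%:~R).
  move: (hq n); rewrite /quad zx zy complex_intE ltcE /=.
  by rewrite !subrr !mulr0 subr0 => /andP[_].
(* Positivity at the two ends of the unit interval around x forces y into the same interval. *)
exists (Num.floor x); rewrite !complex_intE zx zy !ltcR.
have xm : (Num.floor x)%:~R < x.
  rewrite lt_def floor_le andbT; apply/eqP => xE; apply: z_nint.
  by exists (Num.floor x); rewrite zx complex_intE -xE.
have xm1 : x < (Num.floor x + 1)%:~R by exact: floorD1_gt.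
have := hr (Num.floor x); have := hr (Num.floor x + 1).
rewrite nmulr_rgt0 ?subr_lt0// => ->.
by rewrite pmulr_rgt0 ?subr_gt0// => ->; rewrite xm xm1.
Qed.

(** For n < k both arguments of 1/Gamma are positive; from k on, the integer parameter gives a pole
    of Gamma. *)
Lemma rGamma2_degen (R : realType) (z z' : R[i]) (k : int) :
  Zdegen_at k (z, z') ->
  (forall n, n < k -> 0 < rGamma2 R z z' n) /\
  (forall n, k <= n -> rGamma2 R z z' n = 0).
Proof.
have key (u u' : R[i]) : u = k%:~R -> (k - 1)%:~R < u' ->
    (forall n, n < k -> 0 < rGamma2 R u u' n) /\
    (forall n, k <= n -> rGamma2 R u u' n = 0).
  move=> -> u'k; split => n nk.
    rewrite mulr_gt0// rGamma_gt0// subr_gt0 ?ltr_int//.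
    by apply: le_lt_trans u'k; rewrite ler_int; lia.
  rewrite /rGamma2 (_ : rGamma (k%:~R - _) = 0) ?mul0r//.
  apply/rGamma_eq0; exists `|n - k|%N.
  have -> : `|n - k|%N%:R = (n - k)%:~R :> R[i] by rewrite pmulrn; congr intmul; lia.
  by rewrite rmorphB /= opprB.
move=> [_ _ [[zk z'k]|[z'k zk]]]; first exact: key.
by rewrite rGamma2C; exact: key.
Qed.

(** In the principal case this is a squared modulus, nonzero off the real axis. In the complementary
    case the arguments are positive for n <= m, and each further step of [rGamma2_rec] multiplies by
    two negative factors. *)
Lemma rGamma2_gt0 (R : realType) (z z' : R[i]) :
  Zprinc (z, z') \/ Zcompl (z, z') -> forall n, 0 < rGamma2 R z z' n.
Proof.
case=> [[znr z'E] n|[zr z'r [m [/andP[z1 z2] /andP[z'1 z'2]]]]].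
  subst z'; have sE : z^* - n%:~R = (z - n%:~R)^* by rewrite rmorphB /= rmorph_int.
  have s0 : rGamma (z - n%:~R) != 0.
    apply/rGamma_neq0 => k; apply: contra_notN znr.
    rewrite subr_eq => /eqP ->.
    have r : - k%:R + n%:~R \is @Num.real R[i].
      by rewrite realD ?realN ?realn// realz.
    split=> //; move: r; case: (_ + _) => a b.
    by rewrite /= !complex_real oppr_eq0.
  by rewrite /rGamma2 sE rGamma_conj lt_def mulcJ_ge0 mulf_neq0// conjc_eq0.
move=> n; have [mn|nm] := ltP m n; last first.
  rewrite mulr_gt0// rGamma_gt0// subr_gt0.
    by apply: le_lt_trans z1; rewrite ler_int.
  by apply: le_lt_trans z'1; rewrite ler_int.
have [k ->] : exists k : nat, n = m + k%:Z by exists `|n - m|%N; lia.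
elim: k {n mn} => [|k IH].
  by rewrite addr0 mulr_gt0// rGamma_gt0// subr_gt0.
rewrite rGamma2_rec (_ : _ - 1 = m + k%:Z); last lia.
rewrite pmulr_lgt0// /quad -mulrNN !opprB mulr_gt0// subr_gt0.
  by apply: lt_le_trans z2 _; rewrite ler_int; lia.
by apply: lt_le_trans z'2 _; rewrite ler_int; lia.
Qed.

(** * Weights and signatures *)

Definition shifted (N : nat) (lam : {ffun 'I_N -> int}) : seq int :=
  [seq lam i - i.+1%:Z | i <- enum 'I_N].

(* B(n) of the header is [rGamma2 w w' (- n - 1)]. *)
Definition weight (R : realType) (N : nat) (z z' w w' : R[i]) (l : int) : R[i] :=
  rGamma2 R z z' l * rGamma2 R w w' (- (N%:Z + l) - 1).

Lemma PprimeE (R : realType) (N : nat) (lam : {ffun 'I_N -> int})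
    (z z' w w' : R[i]) :
  Pprime lam z z' w w' =
  Dim R lam ^+ 2 * \prod_(l <- shifted N lam) weight R N z z' w w' l.
Proof.
rewrite /Pprime big_map big_enum /=; congr (_ * _); apply: eq_bigr => i _.
rewrite /weight /rGamma2 !mulrA.
have c0 (u : R[i]) : u - (lam i)%:~R + i.+1%:R = u - (lam i - i.+1%:Z)%:~R.
  by rewrite rmorphB /= opprB addrA addrAC -pmulrn.
have c1 (u : R[i]) : u + N%:R + 1 + (lam i)%:~R - i.+1%:R =
    u - (- (N%:Z + (lam i - i.+1%:Z)) - 1)%:~R.
  by rewrite !(rmorphD, rmorphN) /= -!pmulrn; ring.
by rewrite !c0 !c1.
Qed.

Lemma Dim_gt0 (R : realType) (N : nat) (lam : {ffun 'I_N -> int}) :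
  GT lam -> 0 < Dim R lam.
Proof.
move=> gt; apply: prodr_gt0 => i _; apply: prodr_gt0 => j ij.
by have := gt i j (ltnW ij) => ?; apply: divr_gt0; rewrite ltr0z; lia.
Qed.

Lemma size_shifted (N : nat) (lam : {ffun 'I_N -> int}) : size (shifted N lam) = N.
Proof. by rewrite size_map size_enum_ord. Qed.

Lemma nth_shifted (N : nat) (lam : {ffun 'I_N -> int}) (i : 'I_N) :
  nth 0 (shifted N lam) i = lam i - i.+1%:Z.
Proof. by rewrite (nth_map i) ?size_enum_ord// nth_ord_enum. Qed.

Lemma shifted_sorted (N : nat) (lam : {ffun 'I_N -> int}) :
  GT lam -> sorted >%R (shifted N lam).
Proof.
move=> gt; apply/(sortedP 0) => i; rewrite size_shifted => iN.
have := nth_shifted N lam (Ordinal iN); have := nth_shifted N lam (Ordinal (ltnW iN)).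
move=> /= -> ->; have := gt (Ordinal (ltnW iN)) (Ordinal iN) (leqnSn _); lia.
Qed.

Lemma shifted_uniq (N : nat) (lam : {ffun 'I_N -> int}) :
  GT lam -> uniq (shifted N lam).
Proof. by move=> /shifted_sorted/(sorted_uniq (rev_trans lt_trans) ltxx). Qed.

(** Inclusion of duplicate-free lists of equal length would make them equal as sets, and a strictly
    decreasing list is determined by its set. *)
Lemma shifted_neq (N : nat) (lam mu : {ffun 'I_N -> int}) :
  GT lam -> GT mu -> lam <> mu ->
  exists2 x, x \in shifted N mu & x \notin shifted N lam.
Proof.
move=> gl gm; apply: contra_notP => h.
have sub : {subset shifted N mu <= shifted N lam}.
  by move=> x xm; apply: contrapT => /negP xl; apply: h; exists x.
have [|_ eqm] := uniq_min_size (shifted_uniq _ _ gm) sub.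
  by rewrite !size_shifted.
have e : shifted N lam = shifted N mu.
  apply: (irr_sorted_eq (rev_trans lt_trans) ltxx); [exact: shifted_sorted..|].
  by move=> x; rewrite eqm.
apply/ffunP => i; have := nth_shifted N lam i.
by rewrite e nth_shifted => /addIr.
Qed.

(** Sort decreasingly and add the index back: distinct integers drop by at least 1 per step, so the
    result is still weakly decreasing. *)
Lemma GT_of_seq (N : nat) (s : seq int) : uniq s -> size s = N ->
  exists2 lam : {ffun 'I_N -> int}, GT lam & perm_eq (shifted N lam) s.
Proof.
move=> us sN; pose t := rev (sort <=%R s).
have st : sorted >%R t.
  by rewrite /t rev_sorted lt_sorted_uniq_le sort_uniq us sort_le_sorted.
have tN : size t = N by rewrite size_rev size_sort.
have step (a d : nat) : (a + d < size t)%N ->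
    nth 0 t (a + d) + (a + d).+1%:Z <= nth 0 t a + a.+1%:Z.
  elim: d => [|d IH]; first by rewrite addn0.
  rewrite addnS => dt; have := IH (ltnW dt).
  by have /= := (sortedP 0 st) _ dt; lia.
exists [ffun i : 'I_N => nth 0 t i + i.+1%:Z].
  move=> i j ij; rewrite !ffunE -(subnKC ij); apply: step.
  by rewrite subnKC// tN.
rewrite (_ : shifted _ _ = t) ?perm_rev ?perm_sort//.
apply: (@eq_from_nth _ 0); first by rewrite size_shifted tN.
move=> i; rewrite size_shifted => iN.
by rewrite (nth_shifted _ _ (Ordinal iN)) ffunE /= addrK.
Qed.

(** * Necessity: exchanging one point of a signature *)

Lemma weight_ratio_gt0 (R : realType) (N : nat) (z z' w w' : R[i])
    (U : seq int) (n : int) :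
  (forall lam : {ffun 'I_N.+1 -> int}, GT lam -> 0 <= Pprime lam z z' w w') ->
  uniq U -> size U = N.+2 ->
  (forall x, x \in U -> weight R N.+1 z z' w w' x != 0) ->
  weight R N.+1 z z' w w' n != 0 -> weight R N.+1 z z' w w' (n - 1) != 0 ->
  0 < weight R N.+1 z z' w w' n / weight R N.+1 z z' w w' (n - 1).
Proof.
set W := weight R N.+1 z z' w w' => P0 Uu Us U0 n0 n1.
(* Discarding n and n - 1 from the N + 2 points leaves at least N. Completing these N points by n or
   by n - 1 gives two signatures, and the common product cancels in the quotient. *)
pose T := take N [seq x <- U | x \notin [:: n; n - 1]].
have sT : size T = N.
  apply: size_takel; pose p := mem [:: n; n - 1].
  have p2 : (count p U <= 2)%N.
    rewrite -size_filter; apply: (@uniq_leq_size _ _ [:: n; n - 1]).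
      exact: filter_uniq.
    by move=> x; rewrite mem_filter => /andP[].
  have := count_predC p U; rewrite Us size_filter => UE.
  by have : (N <= count (predC p) U)%N by lia.
have uT : uniq T by apply: take_uniq; apply: filter_uniq.
have memT x : x \in T -> x \notin [:: n; n - 1] /\ x \in U.
  by move=> /mem_take; rewrite mem_filter => /andP[].
have key m : m \in [:: n; n - 1] -> W m != 0 ->
    0 < W m * \prod_(x <- T) W x.
  move=> mn m0.
  have [||lam glam plam] := @GT_of_seq N.+1 (m :: T).
  - by rewrite /= uT andbT; apply/negP => /memT[]; rewrite mn.
  - by rewrite /= sT.
  have := P0 lam glam; rewrite PprimeE (perm_big _ plam) /= big_cons.
  rewrite pmulr_rge0 ?exprn_gt0 ?Dim_gt0// => h.
  rewrite lt_def h andbT mulf_neq0//; rewrite prodf_seq_neq0.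
  by apply/allP => x /memT[_ /U0].
have k1 := key n (mem_head _ _) n0.
have k2 : 0 < W (n - 1) * \prod_(x <- T) W x.
  by apply: key n1; rewrite !inE eqxx orbT.
have T0 : \prod_(x <- T) W x != 0.
  by apply: contraTneq k1 => ->; rewrite mulr0 ltxx.
have -> : W n / W (n - 1) =
    (W n * \prod_(x <- T) W x) / (W (n - 1) * \prod_(x <- T) W x).
  by field; rewrite n1 T0.
exact: divr_gt0.
Qed.

Lemma weight_neq0 (R : realType) (N : nat) (lam : {ffun 'I_N -> int})
    (z z' w w' : R[i]) : 0 < Pprime lam z z' w w' ->
  forall x, x \in shifted N lam -> weight R N z z' w w' x != 0.
Proof.
rewrite PprimeE => P0 x xl; apply/eqP => x0; move: P0.
by rewrite (big_rem x)//= x0 mul0r mulr0 ltxx.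
Qed.

Lemma weight_support (R : realType) (N : nat) (z z' w w' : R[i]) :
  Dadm (z, z', w, w') -> (1 <= N)%N ->
  exists U : seq int, [/\ uniq U, size U = N.+1 &
    forall x, x \in U -> weight R N z z' w w' x != 0].
Proof.
move=> [_ _ two] /two [lam [mu [gl gm lm /weight_neq0 pl /weight_neq0 pm]]].
have [x xm xl] := shifted_neq _ _ _ gl gm lm.
exists (x :: shifted N lam); split; last first.
- by move=> y; rewrite inE => /orP[/eqP ->|]; [exact: pm|exact: pl].
- by rewrite /= size_shifted.
- by rewrite /= xl shifted_uniq.
Qed.

Lemma Dadm_quad_ratio (R : realType) (z z' w w' : R[i]) :
  Dadm (z, z', w, w') -> forall n m,
  rGamma2 R z z' n != 0 -> rGamma2 R w w' m != 0 -> n + m <= -1 ->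
  0 < quad R z z' n / quad R w w' m.
Proof.
move=> adm n m An Bm nm.
(* For signatures of length -(n + m), the weight at n pairs A(n) with [rGamma2 w w' (m - 1)], and
   the weight at n - 1 pairs A(n - 1) with [rGamma2 w w' m]. Their quotient is the desired one by
   [rGamma2_rec]. *)
have [N NE] : exists N : nat, N.+1%:Z = - (n + m) by exists (absz (n + m)).-1; lia.
have [U [Uu Us U0]] := weight_support _ N.+1 _ _ _ _ adm isT.
have An1 := An; rewrite rGamma2_rec mulf_eq0 negb_or in An1.
have Bm1 := Bm; rewrite rGamma2_rec mulf_eq0 negb_or in Bm1.
case/andP: An1 => p0 An1; case/andP: Bm1 => q0 Bm1.
have W1 : weight R N.+1 z z' w w' n = rGamma2 R z z' n * rGamma2 R w w' (m - 1).
  by rewrite /weight NE; congr (_ * rGamma2 _ _ _ _); lia.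
have W2 : weight R N.+1 z z' w w' (n - 1) =
    rGamma2 R z z' (n - 1) * rGamma2 R w w' m.
  by rewrite /weight NE; congr (_ * rGamma2 _ _ _ _); lia.
have [_ P0 _] := adm.
have := weight_ratio_gt0 R N z z' w w' U n (fun lam => P0 _ lam isT) Uu Us U0.
rewrite W1 W2 => /(_ (mulf_neq0 An Bm1) (mulf_neq0 An1 Bm)).
rewrite (rGamma2_rec _ z z' n) (rGamma2_rec _ w w' m).
congr (0 < _); field.
by rewrite An1 q0 Bm1.
Qed.

(** * Sufficiency: constant signatures *)

Lemma Pprime_ge0 (R : realType) (N : nat) (lam : {ffun 'I_N -> int})
    (z z' w w' : R[i]) :
  (forall n, 0 <= rGamma2 R z z' n) -> (forall n, 0 <= rGamma2 R w w' n) ->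
  GT lam -> 0 <= Pprime lam z z' w w'.
Proof.
move=> A0 B0 gl; rewrite PprimeE mulr_ge0 ?exprn_ge0 ?(ltW (Dim_gt0 _ _ _ gl))//.
by apply: prodr_ge0 => x _; rewrite mulr_ge0.
Qed.

Lemma Pprime_constant_gt0 (R : realType) (N : nat) (c : int)
    (z z' w w' : R[i]) :
  (forall n, n < c -> 0 < rGamma2 R z z' n) ->
  (forall n, n < - c -> 0 < rGamma2 R w w' n) ->
  0 < Pprime [ffun _ : 'I_N => c] z z' w w'.
Proof.
move=> A0 B0; have gt : GT [ffun _ : 'I_N => c] by move=> i j _; rewrite !ffunE.
rewrite PprimeE mulr_gt0 ?exprn_gt0 ?Dim_gt0//.
rewrite /shifted big_map; apply: prodr_gt0 => i _; rewrite ffunE /weight.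
by have iN := ltn_ord i; apply: mulr_gt0; [apply: A0|apply: B0]; lia.
Qed.

(** The witnesses are the constant signatures c and c + 1. The second needs A positive up to c
    inclusive, while the first is the more demanding one for (w, w'). *)
Lemma Dadm_of_rGamma2 (R : realType) (z z' w w' : R[i]) (c : int) :
  calD (z, z', w, w') ->
  (forall n, 0 <= rGamma2 R z z' n) -> (forall n, 0 <= rGamma2 R w w' n) ->
  (forall n, n <= c -> 0 < rGamma2 R z z' n) ->
  (forall n, n < - c -> 0 < rGamma2 R w w' n) ->
  Dadm (z, z', w, w').
Proof.
move=> D A0 B0 Ac Bc; split=> // [N lam _|[//|N] _]; first exact: Pprime_ge0.
exists [ffun => c], [ffun => c + 1]; split.
- by move=> i j _; rewrite !ffunE.
- by move=> i j _; rewrite !ffunE.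
- by move/ffunP/(_ ord0); rewrite !ffunE; lia.
- by apply: Pprime_constant_gt0 => // n nc; apply: Ac; lia.
- by apply: Pprime_constant_gt0 => n nc; [apply: Ac|apply: Bc]; lia.
Qed.

Lemma Zset_rGamma2 (R : realType) (z z' : R[i]) : Zset (z, z') ->
  (forall n, 0 < rGamma2 R z z' n) \/ exists k, Zdegen_at k (z, z').
Proof.
by case=> [h|[k _ h]]; [left; exact: rGamma2_gt0|right; exists k].
Qed.

Lemma Zdegen_rGamma2_ge0 (R : realType) (z z' : R[i]) (k : int) :
  Zdegen_at k (z, z') -> forall n, 0 <= rGamma2 R z z' n.
Proof.
move=> /rGamma2_degen[pos zero] n; have [/pos/ltW//|kn] := ltP n k.
by rewrite zero.
Qed.

Theorem proposition7p10 (R : realType) (z z' w w' : R[i]) :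
  Dadm (z, z', w, w') <->
  [/\ calD (z, z', w, w'),
      Zset (z, z') /\ Zset (w, w') &
      Zdegen (z, z') -> Zdegen (w, w') ->
        forall k l : int,
          Zdegen_at k (z, z') -> Zdegen_at l (w, w') -> 1 <= k + l].
Proof.
split=> [adm|[D [Zz Zw] kl]].
  have ratio := Dadm_quad_ratio _ _ _ _ _ adm.
  have [D _ _] := adm; split=> //.
    split; apply: Zset_of_quad_gt0; apply: quad_gt0; first exact: ratio.
    (* For (w, w') the same ratio is used inverted. *)
    move=> n m Bn Am nm; rewrite -invf_div invr_gt0; apply: ratio => //.
    by rewrite addrC.
  move=> _ _ k l /rGamma2_degen[_ Ak] /rGamma2_degen[_ Bl].
  (* For N = 1 nonzero weights occur only in [-l - 1, k - 1]; two distinct integers there force k +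
     l >= 1. *)
  have [U [Uu Us U0]] := weight_support _ 1 _ _ _ _ adm isT.
  case: U Uu Us U0 => [|x [|y []]] //= + _ U0.
  rewrite inE andbT => xy.
  have bound u : weight R 1 z z' w w' u != 0 -> - l - 1 <= u < k.
    rewrite /weight mulf_eq0 negb_or => /andP[Au Bu]; apply/andP; split.
      by rewrite leNgt; apply: contra Bu => ?; apply/eqP/Bl; lia.
    by rewrite ltNge; apply: contra Au => ?; apply/eqP/Ak; lia.
  have := bound _ (U0 x (mem_head _ _)).
  have := bound y (U0 y _); rewrite !inE eqxx orbT => /(_ isT).
  by move: xy; lia.
(* The constant c must satisfy c <= k - 1 if the first pair is degenerate and c >= -l if the second
   is; both are possible exactly when k + l >= 1. *)
case: (Zset_rGamma2 _ _ _ Zz) (Zset_rGamma2 _ _ _ Zw) => [A0|[k zk]] [B0|[l wl]].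
- by apply: (Dadm_of_rGamma2 _ _ _ _ _ 0) => // n; exact/ltW.
- have [Bl _] := rGamma2_degen _ _ _ _ wl.
  apply: (Dadm_of_rGamma2 _ _ _ _ _ (- l)) => //.
  + by move=> n; exact/ltW.
  + exact: Zdegen_rGamma2_ge0 wl.
  + by rewrite opprK.
- have [Ak _] := rGamma2_degen _ _ _ _ zk.
  apply: (Dadm_of_rGamma2 _ _ _ _ _ (k - 1)) => //.
  + exact: Zdegen_rGamma2_ge0 zk.
  + by move=> n; exact/ltW.
  + by move=> n nk; apply: Ak; lia.
have [Ak _] := rGamma2_degen _ _ _ _ zk.
have [Bl _] := rGamma2_degen _ _ _ _ wl.
have kl1 : 1 <= k + l by apply: kl => //; [exists k|exists l].
apply: (Dadm_of_rGamma2 _ _ _ _ _ (k - 1)) => //.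
- exact: Zdegen_rGamma2_ge0 zk.
- exact: Zdegen_rGamma2_ge0 wl.
- by move=> n nk; apply: Ak; lia.
- by move=> n nl; apply: Bl; lia.
Qed.
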